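(* For a (Hausdorff) topological space $X$, the following are equivalent: (a) $X$ is countably paracompact and normal. (b) If $E$ is a separable topological vector space, then each convex-valued open relation $\Phi:X\leadsto E$ has a continuous selection. (c) Every convex-valued open relation $\Phi:X\leadsto\mathbb{R}$ has a continuous selection.
   Context: All topological spaces are assumed Hausdorff. All vector spaces are real. A topological vector space is a vector space with a (Hausdorff) topology making the vector operations continuous. A space is countably paracompact if each countable open cover has a locally finite open refinement (covering the space). For a relation $\Phi\subset X\times Y$, $\Phi(x)=\{y\in Y:\langle x,y\rangle\in\Phi\}$; writing $\Phi:X\leadsto Y$ means that $\Phi(x)\neq\varnothing$ for every $x\in X$. $\Phi$ is open if it is an open subset of the product space $X\times Y$, and convex-valued if each $\Phi(x)$ is convex. A selection for $\Phi:X\leadsto Y$ is a map $f:X\to Y$ with $f(x)\in\Phi(x)$ for every $x\in X$. *)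

(* Defs.v *)
From mathcomp Require Import all_boot all_order all_algebra.
From mathcomp Require Import all_classical all_reals all_analysis.
Import numFieldNormedType.Exports.

Set Implicit Arguments.
Unset Strict Implicit.
Unset Printing Implicit Defensive.

Local Open Scope classical_set_scope.

Definition locally_finite (T : topologicalType) (V : set (set T)) : Prop :=
  forall x : T, exists2 N : set T, nbhs x N &
    finite_set [set A | V A /\ A `&` N !=set0].

Definition open_cover (T : topologicalType) (U : set (set T)) : Prop :=
  U `<=` open /\ cover U id = [set: T].

Definition refines (T : Type) (V U : set (set T)) : Prop :=
  forall A, V A -> exists2 B, U B & A `<=` B.

(* [countable] includes finite; covers and refinements are families of sets. *)
Definition countably_paracompact (T : topologicalType) : Prop :=
  forall U : set (set T), countable U -> open_cover U ->
    exists V : set (set T), [/\ open_cover V, refines V U & locally_finite V].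

Definition separable (T : topologicalType) : Prop :=
  exists2 D : set T, countable D & dense D.

(* [Phi : X ~> Y], i.e., every fiber of Phi is nonempty. *)
Definition total_relation (X Y : Type) (Phi : set (X * Y)) : Prop :=
  forall x : X, xsection Phi x !=set0.

Definition convex_valued (R : realType) (X : Type) (E : lmodType R)
    (Phi : set (X * E)) : Prop :=
  forall x : X, convex_set (xsection Phi x).

Definition selection (X Y : Type) (Phi : set (X * Y)) (f : X -> Y) : Prop :=
  forall x : X, xsection Phi x (f x).

(* Main.v *)
Require Import Defs.
From mathcomp Require Import all_boot all_order all_algebra.
From mathcomp Require Import all_classical all_reals all_analysis.
Import numFieldNormedType.Exports.
Import Order.TTheory GRing.Theory Num.Theory.

Local Open Scope classical_set_scope.
Local Open Scope ring_scope.

(** Why the theorem holds.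

    From (a) to (b): pick a dense sequence (d n) in E. The sets
    U n = {x | (x, d n) in Phi} are open because Phi is, and they cover X
    because every nonempty open fiber contains some d n. Countable
    paracompactness gives a locally finite open cover (W n) with W n contained
    in U n ([countably_paracompact_seq]), and Urysohn's lemma gives continuous
    weights phi n >= 0, positive only inside W n and not all zero at any point
    ([normal_cozero_refinement]). The selection is the weighted mean
      f x = (sum_n phi n x)^-1 *: sum_n (phi n x *: d n).
    Near each point the sums are finite, so f is continuous
    ([locally_stationary_limit]); and phi n x > 0 forces d n to lie in the
    convex fiber over x, so f x lies there too ([convex_cone_sum]).

    From (b) to (c): the real line is separable.

    From (c) to (a): two open relations with interval fibers do the work. For
    disjoint closed A and B, let t be related to x when t < 0 if x is in A, and
    t > 1 if x is in B: a selection separates A from B. For a countable open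
    cover U numbered by idx, let t be related to x when t > idx A for some A in
    U containing x. Given a selection f, the sets {x in A | idx A < f x} still
    cover X, and they are locally finite because f is locally bounded. *)

(** * Sequences and finiteness *)

Lemma finite_nat_bounded (A : set nat) :
  finite_set A -> exists M, forall n, A n -> (n < M)%N.
Proof.
move=> /finite_seqP[s ->]; exists (\max_(i <- s) i).+1 => n ns.
by rewrite ltnS; exact: (@leq_bigmax_seq _ s xpredT id).
Qed.

Lemma sum_ord_stationary (V : nmodType) (F : nat -> V) (M m : nat) :
  (M <= m)%N -> (forall k, (M <= k)%N -> F k = 0) ->
  \sum_(i < m) F i = \sum_(i < M) F i.
Proof.
move=> Mm F0; rewrite -(subnKC Mm) big_split_ord /= [X in _ + X]big1 ?addr0//.
by move=> i _; rewrite F0 // leq_addr.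
Qed.

Lemma countable_enum (T : Type) (A : set T) (t0 : T) :
  countable A -> exists d : nat -> T, A `<=` range d.
Proof.
move=> /countable_injP[idx idx_inj].
have /choice[d dP] n : exists t, forall a, A a -> idx a = n -> t = a.
  have [[a Aa idxa]|noa] := pselect (exists2 a, A a & idx a = n); last first.
    by exists t0 => a Aa idxa; case: noa; exists a.
  exists a => b Ab idxb; apply: idx_inj; rewrite ?inE//.
  by rewrite idxa.
by exists d => a Aa; exists (idx a) => //; exact: dP.
Qed.

(** * Locally finite open covers *)

Section locally_finite_cover.
Context {X : topologicalType}.

(** The form in which a locally finite sum is continuous. Continuity of [u M] is
    asked for only at [x]: the weighted means of the first few terms are
    discontinuous where their total weight vanishes. *)
Lemma locally_stationary_limit (Y : topologicalType) (u : nat -> X -> Y) :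
  (forall x, exists M, {for x, continuous (u M)} /\
     \forall y \near x, forall m, (M <= m)%N -> u m y = u M y) ->
  exists2 g : X -> Y, continuous g & forall x, \forall m \near \oo, g x = u m x.
Proof.
move=> /choice[M uM]; exists (fun x => u (M x) x) => [x|x]; last first.
  have [_ /nbhs_singleton uMx] := uM x.
  by exists (M x) => // m /= /uMx.
have [cuM nearM] := uM x.
apply: cvg_trans cuM; apply: near_eq_cvg.
apply: filterS nearM => y uMy.
have [_ /nbhs_singleton uMyy] := uM y.
rewrite -(uMy (maxn (M x) (M y))) ?leq_maxl//.
by rewrite (uMyy (maxn (M x) (M y))) ?leq_maxr.
Qed.

(** A refinement may have many members inside the same [U n]; assigning each
    member to one [n] and uniting those assigned to [n] makes the refinement
    indexed like [U], and it stays locally finite. *)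
Lemma countably_paracompact_seq (U : nat -> set X) :
  countably_paracompact X -> (forall n, open (U n)) ->
  (forall x, exists n, U n x) ->
  exists W : nat -> set X, [/\ forall n, open (W n), forall n, W n `<=` U n,
    forall x, exists n, W n x &
    forall x : X, exists M, \forall y \near x, forall n, (M <= n)%N -> ~ W n y].
Proof.
move=> cpX oU covU.
have oc : open_cover (range U).
  split=> [_ [n _ <-]|]; first exact: oU.
  apply/seteqP; split=> // x _; have [n Unx] := covU x.
  by exists (U n) => //; exists n.
have [|V [[oV covV] VU lfV]] := cpX _ _ oc.
  exact: card_image_le.
have /choice[idx idxP] (A : set X) : exists n, V A -> A `<=` U n.
  have [VA|nVA] := pselect (V A); last by exists 0%N.
  by have [_ [n _ <-] AU] := VU _ VA; exists n.
exists (fun n => \bigcup_(A in [set A | V A /\ idx A = n]) A); split.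
- by move=> n; apply: bigcup_open => A [/oV].
- by move=> n x [A [VA <-] Ax]; exact: idxP.
- move=> x; have : [set: X] x by [].
  by rewrite -covV => -[A VA Ax]; exists (idx A), A.
- move=> x; have [N Nx finN] := lfV x.
  have [M MP] := finite_nat_bounded _ (finite_image idx finN).
  exists M; apply: filterS Nx => y Ny n Mn [A [VA idxA] Ay].
  suff : (n < M)%N by rewrite ltnNge Mn.
  by apply: MP; exists A => //; split=> //; exists y.
Qed.

Lemma normal_cozero_shrink (R : realType) (C W : set X) :
  normal_space X -> closed C -> open W -> C `<=` W ->
  exists f : X -> R, [/\ continuous f, forall x, 0 <= f x,
    forall x, C x -> 0 < f x & forall x, 0 < f x -> W x].
Proof.
move=> nX cC oW CW.
have [|f [cf f0 f1 f01]] :=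
    urysohn_ext_itv nX (open_closedC oW) cC _ (@ltr01 R).
  by rewrite setIC; apply/disjoints_subset; rewrite setCK.
exists f; split=> // x.
- by have /f01 : range f (f x) by []; rewrite /= in_itv/= => /andP[].
- by move=> Cx; rewrite (f1 (f x)) //; exists x.
- by apply: contraPP => nWx; rewrite (f0 (f x)) ?ltxx//; exists x.
Qed.

(** The weights are chosen one after the other. The n-th one comes from
    Urysohn's lemma, applied to [W n] and to the closed set of points which
    neither the earlier cozero sets nor the later [W k] cover. Thus the cozero
    sets chosen so far and the remaining [W k] cover [X] at each stage, and
    point-finiteness carries this over to the limit. *)
Lemma normal_cozero_refinement (R : realType) (W : nat -> set X) :
  normal_space X -> (forall n, open (W n)) -> (forall x, exists n, W n x) ->
  (forall x, exists M, forall n, (M <= n)%N -> ~ W n x) ->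
  exists phi : nat -> X -> R, [/\ forall n, continuous (phi n),
    forall n x, 0 <= phi n x, forall n x, 0 < phi n x -> W n x &
    forall x, exists n, 0 < phi n x].
Proof.
move=> nX oW covW pfW.
pose tail n := \bigcup_(k in [set k | (n <= k)%N]) W k.
have otail n : open (tail n) by apply: bigcup_open => k _; exact: oW.
(* [sh (n, H)] is the n-th weight when [H] is already covered. *)
have /choice[sh shP] (nH : nat * set X) : exists f : X -> R,
    [/\ continuous f, forall x, 0 <= f x, forall x, 0 < f x -> W nH.1 x &
      open nH.2 -> nH.2 `|` tail nH.1 = setT ->
      forall x, ~ (nH.2 `|` tail nH.1.+1) x -> 0 < f x].
  case: nH => n H /=.
  have [[oH covH]|nH] := pselect (open H /\ H `|` tail n = setT); last first.
    exists (fun=> 0); split=> //; first by move=> ?; exact: cvg_cst.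
    - by move=> x; rewrite ltxx.
    - by move=> oH covH; case: nH.
  have [||f [cf f0 fC fW]] :=
      @normal_cozero_shrink R (~` (H `|` tail n.+1)) (W n) nX _ (oW n).
  - by apply: open_closedC; exact: openU.
  - move=> x /not_orP[nHx ntx].
    have : [set: X] x by [].
    rewrite -covH => -[//|[k /=]]; rewrite leq_eqVlt => /predU1P[->//|nk Wkx].
    by case: ntx; exists k.
  - by exists f; split.
(* [H n] is the union of the cozero sets of the first [n] weights. *)
pose fix H n := if n is m.+1 then H m `|` [set x | 0 < sh (m, H m) x] else set0.
pose phi n := sh (n, H n).
have cphi n : continuous (phi n) by have [] := shP (n, H n).
have HP n : open (H n) /\ H n `|` tail n = setT.
  elim: n => [|n [oH covH]] /=.
    split; first exact: open0.
    by apply/seteqP; split=> // x _; right; have [k] := covW x; exists k.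
  split.
    apply: openU => //; rewrite -[X in open X]/(phi n @^-1` [set t | 0 < t]).
    by apply: open_comp => //= x _; exact: cphi.
  apply/seteqP; split=> // x _.
  have [[Hx|tx]|nx] := pselect ((H n `|` tail n.+1) x).
  - by left; left.
  - by right.
  - by left; right; have [_ _ _] := shP (n, H n); exact.
exists phi; split=> //.
- by move=> n; have [] := shP (n, H n).
- by move=> n; have [] := shP (n, H n).
move=> x; have [M WM] := pfW x.
have : (H M `|` tail M) x by rewrite (HP M).2.
case=> [|[k /WM//]]; elim: (M) => [//|n IHn] [/IHn//|phix].
by exists n.
Qed.

End locally_finite_cover.

(** * Convex combinations *)

Section convexity.
Context {R : realType}.

Lemma is_interval_convex_set (A : set R) :
  is_interval A -> convex_set (A : set (convex_lmodType R)).
Proof.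
move=> iA x y t; rewrite !inE => Ax Ay.
have [xy|/ltW yx] := leP (x : R) y.
  by apply: (iA x y) => //; have := convR_itv t xy; rewrite in_itv.
apply: (iA y x) => //; rewrite convC.
set r := (X in conv X y x).
by have := convR_itv r yx; rewrite in_itv.
Qed.

(** The cone over {1} x A, with its apex added. Being
    closed under addition, it yields weighted means with no case distinction
    on which partial total weights vanish. *)
Definition convex_cone {E : lmodType R} (A : set E) (p : R * E) : Prop :=
  p = (0, 0) \/ 0 < p.1 /\ A (p.1^-1 *: p.2).

(** The mean of [s^-1 *: v] and [t^-1 *: w] with weights s / (s + t) and
    t / (s + t) is [(s + t)^-1 *: (v + w)]. *)
Lemma convex_coneD {E : lmodType R} (A : set E) (p q : R * E) :
  convex_set A -> convex_cone A p -> convex_cone A q ->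
  convex_cone A (p.1 + q.1, p.2 + q.2).
Proof.
case: p q => [s v] [t w] cA /= [[-> ->]|[/= s0 Av]].
  by rewrite !add0r.
move=> [[-> ->]|[/= t0 Aw]].
  by rewrite !addr0; right.
right; split => /=; first exact: addr_gt0.
have st0 : 0 < s + t by exact: addr_gt0.
have l0 : 0 <= s / (s + t) by rewrite divr_ge0 // ltW.
have l1 : s / (s + t) <= 1 by rewrite ler_pdivrMr // mul1r lerDl ltW.
have := cA (s^-1 *: v) (t^-1 *: w) (Itv01 l0 l1).
rewrite !inE => /(_ Av Aw); congr A.
rewrite -[LHS]/(_ *: (s^-1 *: v) + (1 - s / (s + t)) *: (t^-1 *: w)) /=.
have -> : 1 - s / (s + t) = t / (s + t).
  by rewrite -[1](@divff _ (s + t)) ?gt_eqF// -mulrBl addrAC subrr add0r.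
by rewrite !scalerA ![_ / (s + t)]mulrC !mulfK ?gt_eqF// scalerDr.
Qed.

Lemma convex_cone_sum {E : lmodType R} (A : set E) (w : nat -> R) (v : nat -> E)
    (n : nat) : convex_set A -> (forall i, 0 <= w i) ->
  (forall i, 0 < w i -> A (v i)) ->
  convex_cone A (\sum_(i < n) w i, \sum_(i < n) w i *: v i).
Proof.
move=> cA w0 Av; elim: n => [|n IHn]; first by rewrite !big_ord0; left.
rewrite !big_ord_recr /=; apply: (convex_coneD _ _ (w n, w n *: v n) cA IHn).
have := w0 n; rewrite le_eqVlt => /predU1P[<-|wn].
  by rewrite scale0r; left.
right; split=> //=; rewrite scalerA mulVf ?gt_eqF// scale1r.
exact: Av.
Qed.

End convexity.

(** * Selections and covering properties *)

Lemma open_convex_selection (R : realType) (X : topologicalType)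
    (E : topologicalLmodType R) (Phi : set (X * E)) :
  countably_paracompact X -> normal_space X -> separable E ->
  total_relation Phi -> convex_valued Phi -> open Phi ->
  exists2 f : X -> E, continuous f & selection Phi f.
Proof.
move=> cpX nX [D cD dD] totPhi cPhi oPhi.
have [d Dd] := countable_enum _ _ 0 cD.
have oPhiX x : open (xsection Phi x).
  rewrite xsectionE; apply: open_comp => // y _.
  by apply: cvg_pair; [exact: cvg_cst|exact: cvg_id].
have [||W [oW WPhi covW lfW]] :=
    countably_paracompact_seq (fun n => ysection Phi (d n)) cpX.
- move=> n; rewrite ysectionE; apply: open_comp => // y _.
  by apply: cvg_pair; [exact: cvg_id|exact: cvg_cst].
- move=> x; have [e [Px]] := dD _ (totPhi x) (oPhiX x).
  move=> /Dd[n _ dn]; exists n; apply/ysectionP; rewrite dn; exact/xsectionP.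
have [//|phi [cphi phi0 phiW phi_gt0]] :=
    normal_cozero_refinement R W nX oW covW _.
  by move=> x; have [M /nbhs_singleton] := lfW x; exists M.
pose s m x := \sum_(i < m) phi i x.
pose v m x := \sum_(i < m) phi i x *: d i.
have s_gt0 x n m : 0 < phi n x -> (n < m)%N -> 0 < s m x.
  move=> phin nm; rewrite /s (bigD1 (Ordinal nm)) //=.
  by rewrite ltr_pwDl // sumr_ge0.
have cs m : continuous (s m).
  by apply: continuous_big => [|i _]; [exact: add_continuous|exact: cphi].
have cv m : continuous (v m).
  apply: continuous_big => [|i _]; first exact: add_continuous.
  move=> x; apply: (continuous2_cvg _ (scale_continuous (_, _))).
    exact: cphi.
  exact: cvg_cst.
have [x|f cf fE] := locally_stationary_limit E (fun m x => (s m x)^-1 *: v m x).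
  have [M nearM] := lfW x; have [n phin] := phi_gt0 x.
  (* [M] makes the later weights vanish near [x], [n.+1] makes the total weight
     positive at [x]. *)
  exists (maxn M n.+1); split.
    apply: (continuous2_cvg _ (scale_continuous (_, _))); last exact: cv.
    apply: cvgV; last exact: cs.
    by rewrite gt_eqF // (s_gt0 _ _ _ phin) // leq_max ltnSn orbT.
  apply: filterS nearM => y WM m Mm.
  have phi_eq0 k : (maxn M n.+1 <= k)%N -> phi k y = 0.
    move=> Mk; apply/eqP; rewrite eq_le phi0 andbT leNgt.
    by apply/negP => /phiW; apply: WM; apply: leq_trans Mk; exact: leq_maxl.
  rewrite /s /v (sum_ord_stationary _ (phi^~ y) _ _ Mm phi_eq0).
  rewrite (sum_ord_stationary _ (fun i => phi i y *: d i) _ _ Mm) //.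
  by move=> k /phi_eq0 ->; rewrite scale0r.
exists f => // x.
have [n phin] := phi_gt0 x; have [m [/= nm ->]] :
    exists m, (n < m)%N /\ f x = (s m x)^-1 *: v m x.
  have [N _ fN] := fE x; exists (maxn N n.+1); split; first exact: leq_maxr.
  by apply: fN; exact: leq_maxl.
have := @convex_cone_sum R E (xsection Phi x) (phi^~ x) d m (cPhi x) _ _.
case=> [|i /phiW|[]|[]//].
- by move=> i; exact: phi0.
- by move=> /WPhi/ysectionP; exact: (xsectionP _ _ _).2.
- by move=> s0; have := s_gt0 _ _ _ phin nm; rewrite /s s0 ltxx.
Qed.

Lemma selection_normal (R : realType) (X : topologicalType) :
  (forall Phi : set (X * R), total_relation Phi ->
     convex_valued Phi -> open Phi ->
     exists2 f : X -> R, continuous f & selection Phi f) ->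
  normal_space X.
Proof.
move=> sel; apply/(@normal_openP R) => A B cA cB AB0.
pose Phi : set (X * R) :=
  (fst @^-1` (~` A) `|` snd @^-1` [set t | t < 0]) `&`
  (fst @^-1` (~` B) `|` snd @^-1` [set t | t > 1]).
have PhiE x t : xsection Phi x t = ((A x -> t < 0) /\ (B x -> 1 < t)).
  apply/propext; split=> [/xsectionP[/= hA hB]|[hA hB]].
    by split=> ?; [case: hA|case: hB].
  apply/xsectionP; split=> /=.
    by have [/hA|] := pselect (A x); [right|left].
  by have [/hB|] := pselect (B x); [right|left].
have [x|x||f cf fPhi] := sel Phi.
- have [Ax|nAx] := pselect (A x).
    exists (-1); rewrite PhiE; split=> [_|Bx]; first by rewrite ltrN10.
    by have : (A `&` B) x by []; rewrite AB0.
  by exists 2; rewrite PhiE; split=> // _; rewrite ltr1n.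
- apply: is_interval_convex_set => s t; rewrite !PhiE => -[As Bs] [At Bt] r.
  move=> /andP[sr rt]; rewrite PhiE; split=> [/At|/Bs].
    exact: le_lt_trans.
  by move=> /lt_le_trans; apply.
- have cfst : continuous (@fst X R) by move=> ?; exact: cvg_fst.
  have csnd : continuous (@snd X R) by move=> ?; exact: cvg_snd.
  apply: openI; apply: openU; apply: open_comp => //; exact: closed_openC.
exists (f @^-1` [set t | t < 0]), (f @^-1` [set t | t > 1]); split.
- by apply: open_comp => //; exact: open_lt.
- by apply: open_comp => //; exact: open_gt.
- by move=> x Ax; have := fPhi x; rewrite PhiE => -[/(_ Ax)].
- by move=> x Bx; have := fPhi x; rewrite PhiE => -[_ /(_ Bx)].
- rewrite -subset0 => x [/= f0 f1].
  by have := lt_trans f1 f0; rewrite ltr10.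
Qed.

Lemma selection_countably_paracompact (R : realType) (X : topologicalType) :
  (forall Phi : set (X * R), total_relation Phi ->
     convex_valued Phi -> open Phi ->
     exists2 f : X -> R, continuous f & selection Phi f) ->
  countably_paracompact X.
Proof.
move=> sel U /countable_injP[idx idx_inj] [oU covU].
have coverP x : exists2 A, U A & A x.
  by have : [set: X] x by []; rewrite -covU => -[A]; exists A.
pose Phi : set (X * R) :=
  \bigcup_(A in U) (fst @^-1` A `&` snd @^-1` [set t | (idx A)%:R < t]).
have [|x||f cf fPhi] := sel Phi.
- move=> x; have [A UA Ax] := coverP x; exists ((idx A)%:R + 1).
  by apply/xsectionP; exists A => //; split=> //=; rewrite ltrDl.
- apply: is_interval_convex_set => s t /xsectionP[A UA [/= Ax As]] _ r.
  move=> /andP[sr _].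
  by apply/xsectionP; exists A => //; split=> //=; exact: lt_le_trans sr.
- apply: bigcup_open => A UA; apply: openI; apply: open_comp => //=.
  + by move=> ? _; exact: cvg_fst.
  + exact: oU.
  + by move=> ? _; exact: cvg_snd.
pose V (A : set X) := A `&` f @^-1` [set t | (idx A)%:R < t].
exists (V @` U); split.
- split=> [_ [A UA <-]|].
    by apply: openI; [exact: oU|apply: open_comp => // x _; exact: cf].
  apply/seteqP; split=> // x _.
  have /xsectionP[A UA [Ax Af]] := fPhi x.
  by exists (V A) => //; exists A.
- by move=> _ [A UA <-]; exists A => // x [].
- move=> x; exists (f @^-1` [set t | t < f x + 1]).
    apply: cf; apply: open_nbhs_nbhs; split=> //=.
    by rewrite ltrDl.
  have [K fxK] : exists K, f x + 1 <= K%:R.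
    exists (Num.bound `|f x + 1|); apply: le_trans (ler_norm _) _.
    exact/ltW/archi_boundP.
  have finU : finite_set [set A | U A /\ (idx A < K)%N].
    rewrite -(eq_finite_set (inj_card_eq (f := idx) _)); last first.
      move=> A B; rewrite !inE => -[UA _] [UB _].
      by apply: idx_inj; rewrite inE.
    by apply: sub_finite_set (finite_II K) => _ [A [_ ?] <-].
  (* Around [x], [f] stays below [K], so only the members numbered below [K]
     are met. *)
  apply: sub_finite_set (finite_image V finU) => _ [[A UA <-]].
  move=> [y [[Ay /= Afy] fy]]; exists A => //; split=> //.
  by rewrite -(ltr_nat R); apply: lt_le_trans fxK; exact: lt_trans fy.
Qed.

Theorem theorem4p4 (R : realType) (X : topologicalType)
    (hX : hausdorff_space X) :
  [<-> (* (a) *) countably_paracompact X /\ normal_space X;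
       (* (b) *) forall E : topologicalLmodType R,
         hausdorff_space E -> separable E ->
         forall Phi : set (X * E), total_relation Phi -> convex_valued Phi ->
           open Phi -> exists2 f : X -> E, continuous f & selection Phi f;
       (* (c) *) forall Phi : set (X * R), total_relation Phi ->
         convex_valued Phi -> open Phi ->
         exists2 f : X -> R, continuous f & selection Phi f].
Proof.
tfae.
- by move=> [cpX nX] E _ sepE Phi; exact: open_convex_selection.
- move=> sel Phi; apply: (sel R); first exact: norm_hausdorff.
  exists (range ratr); last exact: dense_rat.
  by apply: sub_countable (card_image_le _ _) _; exact: countableP.
- by move=> sel; split; [exact: selection_countably_paracompact sel
                        |exact: selection_normal sel].
Qed.
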